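(* Let $f:\mathbb{R}^+\to\mathbb{R}^+$ be non-decreasing with $f(x)\ge2$ for all $x>0$ and $f(x)\le\log x$ for all $x\ge e^2$. Let $0<\varepsilon<\frac1{100}$, $k:=200\lceil\frac1\varepsilon\log^4\frac1\varepsilon\rceil$, and let $\delta$ be defined by $1/\delta=16k^{f(k)-1}$. Let $\mathcal{F}$ be a hereditary family of graphs with the $f$-Erdős–Hajnal property, and let $G$ be a graph on $n$ vertices which is $(\delta/k)$-close to $\mathcal{F}$. Then there is $S\subseteq V(G)$ with $|S|\ge\delta n$ such that $G[S]$ or its complement $\overline{G}[S]$ has maximum degree at most $\varepsilon(|S|-1)$.
   Context: Logarithms are natural. A family of graphs is hereditary if closed under induced subgraphs. A homogeneous set is a clique or an independent set. $\mathcal{F}$ has the $f$-Erdős–Hajnal property if for every real $k\ge1$, every graph in $\mathcal{F}$ with at least $k^{f(k)}$ vertices has a homogeneous set of size at least $k$. A graph $G$ on $n$ vertices is $\alpha$-close to $\mathcal{F}$ if one can add or delete at most $\alpha n^2/2$ edges of $G$ to obtain a graph in $\mathcal{F}$. *)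

(* Defs.v *)
From mathcomp Require Import all_boot all_order all_algebra.
From mathcomp Require Import reals sequences exp.

Set Implicit Arguments.
Unset Strict Implicit.
Unset Printing Implicit Defensive.

Import Order.TTheory GRing.Theory Num.Theory.
Local Open Scope ring_scope.

Record sgraph (V : finType) := SGraph {
  adj :> rel V;
  adj_sym : symmetric adj;
  adj_irr : irreflexive adj }.

Section Graphs.
Variables (V : finType) (G : sgraph V).

Definition edges : {set {set V}} :=
  [set [set p.1; p.2] | p : V * V & G p.1 p.2].

Definition degree (v : V) : nat := #|[set w | G v w]|.

(* As a bound on every degree, so that it also makes sense when V is empty. *)
Definition max_degree_le (R : realType) (d : R) : Prop :=
  forall v : V, (degree v)%:R <= d.

Definition clique (S : {set V}) : Prop :=
  {in S &, forall x y, x != y -> G x y}.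

Definition independent (S : {set V}) : Prop :=
  {in S &, forall x y, ~~ G x y}.

Definition homogeneous (S : {set V}) : Prop := clique S \/ independent S.

Definition compl_rel : rel V := fun x y => (x != y) && ~~ G x y.

Lemma compl_sym : symmetric compl_rel.
Proof. by move=> x y; rewrite /compl_rel eq_sym adj_sym. Qed.

Lemma compl_irr : irreflexive compl_rel.
Proof. by move=> x; rewrite /compl_rel eqxx. Qed.

Definition compl : sgraph V := SGraph compl_sym compl_irr.

Section Induced.
Variable S : {set V}.

Definition induced_rel : rel {x : V | x \in S} := fun x y => G (val x) (val y).

Lemma induced_sym : symmetric induced_rel.
Proof. by move=> x y; rewrite /induced_rel adj_sym. Qed.

Lemma induced_irr : irreflexive induced_rel.
Proof. by move=> x; rewrite /induced_rel adj_irr. Qed.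

Definition induced : sgraph {x : V | x \in S} := SGraph induced_sym induced_irr.
End Induced.

End Graphs.

Definition graph_family := forall V : finType, sgraph V -> Prop.

(* Closure under isomorphism is not required. *)
Definition hereditary (F : graph_family) : Prop :=
  forall (V : finType) (G : sgraph V) (S : {set V}), F V G -> F _ (induced G S).

Definition erdos_hajnal (R : realType) (f : R -> R) (F : graph_family) : Prop :=
  forall k : R, 1 <= k ->
  forall (V : finType) (G : sgraph V), F V G -> k `^ f k <= #|V|%:R ->
  exists S : {set V}, homogeneous G S /\ k <= #|S|%:R.

Definition edit_distance (V : finType) (G H : sgraph V) : nat :=
  #|(edges G :\: edges H) :|: (edges H :\: edges G)|.

Definition close_to (R : realType) (alpha : R) (F : graph_family)
    (V : finType) (G : sgraph V) : Prop :=
  exists H : sgraph V,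
    F V H /\ (edit_distance G H)%:R <= alpha * #|V|%:R ^+ 2 / 2.

(* Main.v *)
Require Import Defs.
From mathcomp Require Import all_boot all_order all_algebra.
From mathcomp Require Import boolp reals sequences exp.
From mathcomp Require Import ring lra.

(* Put [m = k^f(k)], so that [delta = k / (16 m)]; suppose that no set [S] works.
   By the Kleitman-Winston argument, here run on the independence polynomial,
   [G] and its complement then have few independent [k]-sets: every set of at
   least [delta n] vertices has a vertex of large relative degree, so after about
   [ln (1 / delta) / eps] choices an independent set is confined to [delta n]
   vertices. Hence [G] has at most about [(e n / 16 m)^k] homogeneous [k]-sets.
   On the other hand a random sample of about [2 m] vertices contains few edited
   pairs, so it contains [m] vertices inducing a member of [F], and therefore a
   homogeneous [k]-set. So [G] has at least about [(n / 2 m)^k] of them, which is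
   more. If [n <= 8 m] there is no room for sampling, but then deleting an
   endpoint of every edited pair and applying the Erdos-Hajnal property with
   [delta n] in place of [k] directly gives a large enough homogeneous set. *)

Set Implicit Arguments.
Unset Strict Implicit.
Unset Printing Implicit Defensive.

Import Order.TTheory GRing.Theory Num.Theory.
Local Open Scope ring_scope.

(** * Upper bounds through the independence polynomial *)

Section IndependencePolynomial.
Variables (R : realType) (V : finType).
Implicit Types (G : sgraph V) (U A S : {set V}).

Definition independentb G A := [forall x in A, forall y in A, ~~ G x y].

Lemma independentP G A : reflect (independent G A) (independentb G A).
Proof.
apply: (iffP forall_inP) => [h x y xA yA|h x xA].
  by move/forall_inP: (h x xA); apply.
by apply/forall_inP => y yA; apply: h.
Qed.

Definition indep_poly G (x : R) U : R :=
  \sum_(A : {set V} | (A \subset U) && independentb G A) x ^+ #|A|.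

(** Split by whether [v] is a member: an independent set containing [v] loses a factor [x] and lands
    among the non-neighbours of [v] when [v] is removed. *)
Lemma indep_poly_delete G x U v : 0 <= x -> v \in U ->
  indep_poly G x U <=
    indep_poly G x (U :\ v) + x * indep_poly G x [set w in U :\ v | ~~ G v w].
Proof.
move=> x0 vU; rewrite {1}/indep_poly (bigID (fun A : {set V} => v \in A)) /= addrC.
apply: lerD.
  rewrite /indep_poly le_eqVlt; apply/orP; left; apply/eqP.
  by apply: eq_bigl => A; rewrite subsetD1 -!andbA; congr (_ && _); rewrite andbC.
rewrite (reindex_onto (fun A => v |: A) (fun A => A :\ v)); last first.
  by move=> A /andP[_ vA]; rewrite setD1K.
rewrite /indep_poly mulr_sumr.
rewrite [leLHS](_ : _ = \sum_(A : {set V} | ((v |: A \subset U) &&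
  independentb G (v |: A) && (v \in v |: A)) && ((v |: A) :\ v == A)) x * x ^+ #|A|).
  rewrite [leLHS]big_mkcond [leRHS]big_mkcond; apply: ler_sum => A _.
  case: ifP; last by move=> _; case: ifP => // _; rewrite mulr_ge0 ?exprn_ge0.
  move=> /andP[/andP[/andP[sub ind] _] /eqP e].
  have vA : v \notin A by rewrite -e setD11.
  suff -> : (A \subset [set w in U :\ v | ~~ G v w]) && independentb G A by [].
  move/independentP: ind => ind; apply/andP; split.
    apply/subsetP => w wA; rewrite !inE; apply/andP; split.
      apply/andP; split; first by apply: contraNneq vA => <-.
      by apply: (subsetP sub); rewrite setU1r.
    by apply: ind; rewrite ?setU11 ?setU1r.
  by apply/independentP => a b aA bA; apply: ind; rewrite setU1r.
apply: eq_bigr => A /andP[_ /eqP e].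
have vA : v \notin A by rewrite -e setD11.
by rewrite cardsU1 vA exprS.
Qed.

Lemma card_nonneighbours G U v : v \in U ->
  (#|[set w in U :\ v | ~~ G v w]| + #|[set w in U | G v w]|)%N = #|U :\ v|.
Proof.
move=> vU; rewrite -(cardsID [set w | G v w] (U :\ v)) addnC; congr (_ + _)%N.
  apply: eq_card => w; rewrite !inE; case: eqVneq => //= ->.
  by rewrite adj_irr andbF.
by apply: eq_card => w; rewrite !inE andbC.
Qed.

(** By induction, both branches of the deletion recursion are bounded by [(1 + x) ^+ #|U :\ v|]. *)
Lemma indep_poly_le_exp G x U : 0 <= x -> indep_poly G x U <= (1 + x) ^+ #|U|.
Proof.
move=> x0; move: {2}#|U| (leqnn #|U|) => N; elim: N U => [|N IH] U.
  rewrite leqn0 cards_eq0 => /eqP ->; rewrite cards0 expr0.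
  rewrite /indep_poly (big_pred1 set0) ?cards0 // => A /=.
  rewrite subset0; case: eqP => //= ->; apply/independentP => a b.
  by rewrite inE.
have [-> _|[v vU] hU] := set_0Vmem U; first by apply: IH; rewrite cards0.
have cU : #|U| = #|U :\ v|.+1 by rewrite (cardsD1 v U) vU.
apply: le_trans (indep_poly_delete G x0 vU) _.
rewrite cU exprS mulrDl mul1r; rewrite cU ltnS in hU; apply: lerD; first exact: IH.
apply: ler_wpM2l => //; have h := card_nonneighbours G vU.
apply: le_trans (IH _ _) _; first by apply: leq_trans hU; rewrite -h leq_addr.
by apply: ler_weXn2l; [rewrite lerDl | rewrite -h leq_addr].
Qed.

Lemma card_indep_le G (x : R) (K : nat) : 0 <= x ->
  #|[set A : {set V} | independentb G A & #|A| == K]|%:R * x ^+ K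
    <= indep_poly G x setT.
Proof.
move=> x0; rewrite -sum1_card natr_sum mulr_suml /indep_poly.
rewrite [leLHS]big_mkcond [leRHS]big_mkcond; apply: ler_sum => A _.
rewrite inE subsetT /=; case: independentb => //=.
by case: eqP => [->|_]; rewrite ?mul1r // exprn_ge0.
Qed.

Lemma max_degree_leN G U (d : R) : ~ max_degree_le (induced G U) d ->
  exists2 v, v \in U & d < #|[set w in U | G v w]|%:R.
Proof.
move=> /existsNP[[v vU]] /negP; rewrite -ltNge => h; exists v => //.
rewrite (lt_le_trans h) // ler_nat /degree -(card_imset _ val_inj) subset_leq_card //.
by apply/subsetP => _ /imsetP[[w wU] +] ->; rewrite !inE /= wU.
Qed.

(* A vertex of relative degree at least [eps] is available as long as [U] has
   size at least [d]; choosing it shrinks [U] by a factor [1 - eps], so that an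
   independent set makes at most [L] choices before it is confined to [d]
   vertices. Each choice contributes a factor [1 + x * #|V|]. *)
Lemma indep_poly_le G (eps d x : R) (L : nat) :
  0 < eps < 1 -> 0 <= d -> 0 <= x ->
  (forall U, d <= #|U|%:R -> ~ max_degree_le (induced G U) (eps * (#|U|%:R - 1))) ->
  (1 - eps) ^+ L * #|V|%:R <= d ->
  indep_poly G x setT <= expR (x * d) * (1 + x * #|V|%:R) ^+ L.
Proof.
move=> /andP[e0 e1] d0 x0 hU.
have small (U : {set V}) : #|U|%:R <= d -> indep_poly G x U <= expR (x * d).
  move=> Ud; apply: le_trans (indep_poly_le_exp G U x0) _.
  apply: (@le_trans _ _ (expR (x * #|U|%:R))).
    rewrite expRM_natr; apply: lerXn2r; rewrite ?nnegrE ?expR_ge0 ?expR_ge1Dx //.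
    by rewrite addr_ge0.
  by rewrite ler_expR ler_wpM2l.
have xV0 : 0 <= x * #|V|%:R by rewrite mulr_ge0.
suff H j (U : {set V}) : (1 - eps) ^+ j * #|U|%:R <= d ->
    indep_poly G x U <= expR (x * d) * (1 + x * #|V|%:R) ^+ j.
  by move=> h; apply: H; rewrite cardsT.
elim: j U => [|j IH] U; first by rewrite !expr0 mul1r mulr1; apply: small.
move=> hj; set C := expR _ * _ ^+ j in IH.
have C1 : expR (x * d) <= C.
  by rewrite /C ler_peMr ?expR_ge0 // exprn_ege1 // lerDl.
have C0 : 0 <= C by apply: le_trans C1; rewrite expR_ge0.
rewrite exprS mulrCA -/C.
(* With [#|U|] in place of [#|V|] an inner induction on [#|U|] closes: deleting [v] frees exactly
   [x * C], which pays for the branch choosing [v], handled by the outer induction on [j]. *)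
suff: indep_poly G x U <= (1 + x * #|U|%:R) * C.
  move/le_trans; apply; apply: ler_wpM2r => //.
  by rewrite lerD2l ler_wpM2l // ler_nat max_card.
move: {2}#|U| (leqnn #|U|) hj => N; elim: N U => [|N IHN] U UN hj.
  apply: le_trans (small _ _) _.
    by move: UN; rewrite leqn0 => /eqP ->.
  by apply: le_trans C1 _; rewrite ler_peMl // lerDl mulr_ge0.
have [Ud|Ud] := leP d #|U|%:R; last first.
  apply: le_trans (small _ (ltW Ud)) _.
  by apply: le_trans C1 _; rewrite ler_peMl // lerDl mulr_ge0.
have [v vU hv] := max_degree_leN (hU U Ud).
have cU : #|U| = #|U :\ v|.+1 by rewrite (cardsD1 v U) vU.
have q0 : 0 <= 1 - eps by lra.
apply: le_trans (indep_poly_delete G x0 vU) _.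
rewrite cU -(natr1 #|U :\ v|) [leRHS](_ : _ = (1 + x * #|U :\ v|%:R) * C + x * C);
  last by ring.
apply: lerD.
  apply: IHN; first by rewrite -ltnS -cU.
  apply: le_trans hj; apply: ler_wpM2l; first exact: exprn_ge0.
  by rewrite ler_nat cU.
apply: ler_wpM2l => //; apply: IH; apply: le_trans hj.
rewrite exprSr -mulrA; apply: ler_wpM2l; first exact: exprn_ge0.
(* The [- 1] in the degree bound matches [#|U :\ v|]: fewer than [(1 - eps) * #|U :\ v|] vertices
   survive the choice. *)
have h := card_nonneighbours G vU.
move/(congr1 (fun n => n%:R : R)): h; rewrite natrD.
move: hv; rewrite cU -(natr1 #|U :\ v|) => hv h.
nra.
Qed.

End IndependencePolynomial.

(** * Counting forms of probability estimates for random maps *)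

Section Counting.
Implicit Types I J V : finType.

(** A random map takes prescribed values along [g] with probability at most [|V|^-|I|]: overwriting
    these values by arbitrary ones is injective. *)
Lemma card_prescribed I J V (g : I -> J) (a : I -> V) : injective g ->
  (#|[set phi : {ffun J -> V} | [forall i, phi (g i) == a i]]| * #|V| ^ #|I|
     <= #|V| ^ #|J|)%N.
Proof.
move=> ginj; set P := [set phi | _].
pose swap (p : {ffun J -> V} * {ffun I -> V}) : {ffun J -> V} :=
  [ffun j => if [pick i | g i == j] is Some i then p.2 i else p.1 j].
have swapg p i : swap p (g i) = p.2 i.
  rewrite ffunE; case: pickP => [i' /eqP /ginj -> //|/(_ i)].
  by rewrite eqxx.
rewrite -!card_ffun -[X in (_ * X <= _)%N]cardsT -cardsX -(@card_in_imset _ _ swap);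
  first exact: max_card.
move=> [p b] [q c]; rewrite !inE !andbT /= => /forallP hp /forallP hq e.
have ebc : b = c by apply/ffunP => i; rewrite -(swapg (p, b)) e swapg.
congr (_, _) => //; apply/ffunP => j.
have [i /eqP ij|nij] := pickP (fun i => g i == j).
  by rewrite -ij (eqP (hp i)) (eqP (hq i)).
move/ffunP: e => /(_ j); rewrite !ffunE.
by case: pickP => // i; rewrite nij.
Qed.

(** Union bound over the injective choices of a preimage for each element of [A], at most [|J|^|A|]
    in number. *)
Lemma card_cover J V (A : {set V}) :
  (#|[set phi : {ffun J -> V} | A \subset [set phi j | j : J]]| * #|V| ^ #|A|
     <= #|J| ^ #|A| * #|V| ^ #|J|)%N.
Proof.
set P := [set phi | _]; pose a (i : 'I_#|A|) := enum_val i.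
pose Q (g : {ffun 'I_#|A| -> J}) :=
  [set phi : {ffun J -> V} | [forall i, phi (g i) == a i]].
have PQ : P \subset \bigcup_(g : {ffun 'I_#|A| -> J} | injectiveb g) Q g.
  apply/subsetP => phi; rewrite inE => /subsetP hphi.
  have /fin_all_exists[g hg] : forall i : 'I_#|A|, exists j, phi j = a i.
    by move=> i; case/imsetP: (hphi _ (enum_valP i)) => j _ e; exists j.
  apply/bigcupP; exists [ffun i => g i].
    apply/injectiveP => i i'; rewrite !ffunE => e.
    by apply: enum_val_inj; rewrite -/(a i) -/(a i') -!hg e.
  by rewrite inE; apply/forallP => i; rewrite ffunE hg.
apply: leq_trans (leq_mul (subset_leq_card PQ) (leqnn _)) _.
apply: (@leq_trans ((\sum_(g : {ffun 'I_#|A| -> J} | injectiveb g) #|Q g|) * #|V| ^ #|A|)).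
  rewrite leq_mul2r; apply/orP; right.
  elim/big_rec2: _ => [|g n B _ IH]; first by rewrite cards0.
  by apply: leq_trans (leq_card_setU _ _) _; rewrite leq_add2l.
rewrite big_distrl /=.
apply: (@leq_trans (\sum_(g : {ffun 'I_#|A| -> J} | injectiveb g) #|V| ^ #|J|)).
  apply: leq_sum => g /injectiveP ginj.
  by have := card_prescribed a ginj; rewrite card_ord.
rewrite sum_nat_const leq_mul2r; apply/orP; right.
by apply: leq_trans (max_card _) _; rewrite card_ffun card_ord.
Qed.

(** First moment: an ordered pair of distinct indices lands in [B] with probability at most
    [|B| / |V|^2], by [card_prescribed] with a two-element [I]. *)
Lemma sum_card_pairs J V (B : {set V * V}) :
  ((\sum_(phi : {ffun J -> V})
     #|[set p : J * J | (p.1 != p.2) && ((phi p.1, phi p.2) \in B)]|) * #|V| ^ 2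
   <= #|J| ^ 2 * #|B| * #|V| ^ #|J|)%N.
Proof.
under eq_bigr => phi _ do rewrite -sum1_card big_mkcond /=.
rewrite exchange_big big_distrl /= (_ : #|J| ^ 2 = #|{: J * J}|)%N;
  last by rewrite card_prod mulnn.
rewrite -mulnA -sum_nat_const; apply: leq_sum => -[i j] _ /=.
rewrite -big_mkcond /=; have [->|ij] := eqVneq i j.
  by rewrite big_pred0 // => phi; rewrite inE /= eqxx.
pose g (b : bool) := if b then i else j.
have ginj : injective g.
  by move=> [] [] //= e; rewrite /g e eqxx in ij.
pose Q (b : V * V) :=
  [set phi : {ffun J -> V} | [forall c, phi (g c) == (if c then b.1 else b.2)]].
apply: (@leq_trans (\sum_(b in B) #|Q b| * #|V| ^ 2)%N).
  rewrite -big_distrl /= leq_mul2r; apply/orP; right.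
  under [leqRHS]eq_bigr => b _ do rewrite -sum1_card.
  rewrite (exchange_big_dep xpredT) //= big_mkcond; apply: leq_sum => phi _.
  case: ifP => //; rewrite inE /= ij /= => phiB.
  rewrite (bigD1 (phi i, phi j)) ?phiB ?inE //=.
  by apply/forallP => -[].
rewrite -sum_nat_const; apply: leq_sum => b _.
by have := card_prescribed (fun c => if c then b.1 else b.2) ginj; rewrite card_bool.
Qed.

(* Removing the first index of every bad pair. *)
Lemma large_pairless J (B : {set J * J}) :
  exists2 T : {set J}, (#|J| <= #|T| + #|B|)%N &
    forall p, p \in B -> ~ (p.1 \in T /\ p.2 \in T).
Proof.
exists (~: [set p.1 | p in B]).
  by rewrite -(cardsC [set p.1 | p in B]) addnC leq_add2l leq_imset_card.
move=> p pB []; rewrite inE => /negP h _; apply: h.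
by apply/imsetP; exists p.
Qed.

End Counting.

(** * Edited edges as ordered pairs *)

Section EditedPairs.
Variables (V : finType) (G H : sgraph V).

Definition edited := [set p : V * V | G p.1 p.2 != H p.1 p.2].

Lemma mem_edges (K : sgraph V) x y : ([set x; y] \in edges K) = K x y.
Proof.
apply/imsetP/idP => [[[a b] /=]|Kxy]; last by exists (x, y); rewrite ?inE.
rewrite inE /= => Kab e.
have ab : a != b by apply: contraTneq Kab => ->; rewrite adj_irr.
have ha : a \in [set x; y] by rewrite e !inE eqxx.
have hb : b \in [set x; y] by rewrite e !inE eqxx orbT.
move: ha hb ab Kab; rewrite !inE.
move=> /orP[]/eqP-> /orP[]/eqP->; rewrite ?eqxx //= => _.
by rewrite adj_sym.
Qed.

(** Each edited edge is the set of endpoints of at most two ordered pairs. *)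
Lemma card_edited : (#|edited| <= 2 * edit_distance G H)%N.
Proof.
rewrite /edit_distance; set D := _ :|: _.
pose end_set (p : V * V) := [set p.1; p.2].
have hD p : p \in edited -> end_set p \in D.
  case: p => x y; rewrite !inE /end_set /= !mem_edges.
  by case: (G x y); case: (H x y).
rewrite -sum1_card (partition_big end_set (mem D)) //=.
rewrite mulnC -sum_nat_const; apply: leq_sum => e eD; rewrite sum1_card.
have [[x y] /andP[_ /eqP <-]|none] :=
    pickP (fun p : V * V => (p \in edited) && (end_set p == e)); last first.
  by rewrite eq_card0.
apply: leq_trans (_ : #|[set (x, y); (y, x)]| <= 2)%N; last first.
  by rewrite cards2; case: eqP.
apply/subset_leq_card/subsetP => -[a b] /andP[]; rewrite inE /= => ab /eqP.
rewrite /end_set /= => exy.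
have nab : a != b by apply: contraNneq ab => ->; rewrite !adj_irr.
have ha : a \in [set x; y] by rewrite -exy !inE eqxx.
have hb : b \in [set x; y] by rewrite -exy !inE eqxx orbT.
move: ha hb nab; rewrite !inE.
by move=> /orP[]/eqP-> /orP[]/eqP->; rewrite ?eqxx ?orbT.
Qed.

End EditedPairs.

(** * Lower bounds on homogeneous sets by sampling *)

Section HomogeneousSets.
Variable V : finType.
Implicit Types (G H : sgraph V) (A S : {set V}).

Lemma homogeneous_independentb G S : homogeneous G S ->
  independentb G S || independentb (compl G) S.
Proof.
case=> [cl|ind]; apply/orP; [right|left]; apply/independentP => // x y xS yS.
by rewrite /= /compl_rel; case: eqVneq => //= xy; rewrite negbK cl.
Qed.

Lemma independentb_sub G A S : A \subset S -> independentb G S -> independentb G A.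
Proof.
move=> /subsetP AS /independentP ind; apply/independentP => x y xA yA.
by apply: ind; apply: AS.
Qed.

Lemma homogeneous_max_degree (R : realType) G S (eps : R) :
  homogeneous G S -> 0 <= eps -> (0 < #|S|)%N ->
  max_degree_le (induced G S) (eps * (#|S|%:R - 1)) \/
  max_degree_le (induced (compl G) S) (eps * (#|S|%:R - 1)).
Proof.
move=> /homogeneous_independentb /orP ind e0 S0.
have b0 : 0 <= eps * (#|S|%:R - 1) by rewrite mulr_ge0 // subr_ge0 ler1n.
by case: ind => /independentP ind; [left|right] => -[v vS];
  rewrite /degree eq_card0 // => -[w wS]; rewrite inE /=;
  apply: negbTE; apply: ind.
Qed.

Definition homogeneous_sets G (K : nat) :=
  [set A : {set V} | (independentb G A || independentb (compl G) A) & #|A| == K].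

Lemma exists_subset_card S (K : nat) : (K <= #|S|)%N ->
  exists2 A : {set V}, A \subset S & #|A| = K.
Proof.
move=> KS; exists [set x in take K (enum S)].
  by apply/subsetP => x; rewrite inE => /mem_take; rewrite mem_enum.
rewrite cardsE; rewrite (card_uniqP (_ : uniq (take K (enum S)))) ?take_uniq ?enum_uniq //.
by rewrite size_takel // -cardE.
Qed.

(** The diagonal is included so that a map avoiding bad pairs is injective. *)
Definition bad_pairs G H := [set p : V * V | (p.1 == p.2) || (p \in edited G H)].

Lemma card_bad_pairs G H : (#|bad_pairs G H| <= #|V| + 2 * edit_distance G H)%N.
Proof.
rewrite (_ : bad_pairs G H = [set (x, x) | x : V] :|: edited G H).
  apply: leq_trans (leq_card_setU _ _) _; apply: leq_add (card_edited G H).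
  by apply: leq_trans (leq_imset_card _ _) _; rewrite max_card.
apply/setP => -[x y]; rewrite !inE /=; congr (_ || _).
by apply/eqP/imsetP => [->|[z _ [-> ->]]] //; exists y.
Qed.

Variables (R : realType) (f : R -> R) (F : graph_family).
Hypotheses (F_her : hereditary F) (F_EH : erdos_hajnal f F).

(** Deleting an index of every bad pair leaves at least [c^f(c)] indices, on which [phi] is
    injective and [G] agrees with [H]; heredity and the Erdős-Hajnal property of [H] then apply. *)
Lemma homogeneous_in_image G H (J : finType) (phi : J -> V) (c : R) :
  F H -> 1 <= c ->
  c `^ f c + #|[set p : J * J |
     (p.1 != p.2) && ((phi p.1, phi p.2) \in bad_pairs G H)]|%:R <= #|J|%:R ->
  exists2 S : {set V}, S \subset [set phi j | j : J] & homogeneous G S /\ c <= #|S|%:R.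
Proof.
move=> FH c1; set B := [set p | _] => hc.
have [T hT nT] := large_pairless B.
have notbad i j : i \in T -> j \in T -> i != j -> (phi i, phi j) \notin bad_pairs G H.
  move=> iT jT ij; apply/negP => b; apply: (nT (i, j)); last by [].
  by rewrite inE /= ij b.
have inj : {in T &, injective phi}.
  move=> i j iT jT e; apply/eqP; apply/negPn/negP => ij.
  by have := notbad i j iT jT ij; rewrite inE /= e eqxx.
have agree i j : i \in T -> j \in T -> G (phi i) (phi j) = H (phi i) (phi j).
  move=> iT jT; have [->|ij] := eqVneq i j; first by rewrite !adj_irr.
  have := notbad i j iT jT ij; rewrite !inE /= negb_or negbK.
  by case/andP => _ /eqP.
set T' := phi @: T.
have agree' x y : x \in T' -> y \in T' -> G x y = H x y.
  by move=> /imsetP[i iT ->] /imsetP[j jT ->]; apply: agree.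
have [|S0 [hom cS]] := F_EH c1 (F_her T' FH).
  rewrite card_sig (_ : #|_| = #|T|); last by rewrite -(card_in_imset inj); apply: eq_card.
  have : (#|J|%:R : R) <= #|T|%:R + #|B|%:R by rewrite -natrD ler_nat.
  by lra.
exists (val @: S0).
  apply/subsetP => _ /imsetP[[x xT] _ ->] /=.
  by case/imsetP: (xT) => i _ ->; apply: imset_f.
rewrite card_imset; last exact: val_inj.
split=> //; case: hom => h; [left|right].
  move=> _ _ /imsetP[[x xT] xS ->] /imsetP[[y yT] yS ->] /= xy.
  by rewrite agree' //; apply: (h _ _ xS yS); apply: contraNneq xy => -[->].
move=> _ _ /imsetP[[x xT] xS ->] /imsetP[[y yT] yS ->] /=.
by rewrite agree' //; apply: (h _ _ xS yS).
Qed.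

(* A random map ['I_M -> V] with [M] close to [2 * m] has at most [M - m] bad
   pairs with probability at least 1/8, by Markov's inequality. *)
Lemma many_homogeneous_sets G H (K : nat) (m : R) :
  F H -> (0 < K)%N -> m = K%:R `^ f K%:R -> 10 <= m -> 8 * m < #|V|%:R ->
  (edit_distance G H)%:R <= #|V|%:R ^+ 2 / (32 * m) ->
  #|V|%:R ^+ K <= 8 * #|homogeneous_sets G K|%:R * (21 / 10 * m) ^+ K.
Proof.
move=> FH K0 mE m10 Vm hE.
(* [M] exceeds [2 * m], so a map that is not good has more than [m] bad pairs; [10 <= m] absorbs the
   rounding into [21 / 10]. *)
pose M := (Num.truncn (2 * m)).+1.
have M1 : 2 * m < M%:R :> R by exact: truncnS_gt.
have M2 : M%:R <= 21 / 10 * m.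
  have : (Num.truncn (2 * m))%:R <= 2 * m by rewrite truncn_le; lra.
  by rewrite /M -natr1; lra.
pose n : R := #|V|%:R; rewrite -/n in Vm hE *.
have n0 : 0 < n by lra.
pose B (phi : {ffun 'I_M -> V}) := [set p : 'I_M * 'I_M |
  (p.1 != p.2) && ((phi p.1, phi p.2) \in bad_pairs G H)].
pose good := [set phi | #|B phi|%:R <= M%:R - m].
have cgood : n ^+ M <= 8 * #|good|%:R.
  have tot : #|good|%:R + #|~: good|%:R = n ^+ M.
    by rewrite -natrD cardsC card_ffun card_ord natrX.
  have markov : #|~: good|%:R * m <= \sum_phi #|B phi|%:R.
    rewrite -sum1_card natr_sum mulr_suml big_mkcond; apply: ler_sum => phi _.
    rewrite !inE; case: (leP #|B phi|%:R (M%:R - m)) => h /=; rewrite ?mul1r //; lra.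
  have := sum_card_pairs 'I_M (bad_pairs G H); rewrite card_ord.
  rewrite -(ler_nat R) !natrM !natrX natr_sum -/n => first_moment.
  (* The diagonal gives [n], below [n^2 / (8 m)], and the edits give at most [n^2 / (16 m)]. *)
  have cbad : #|bad_pairs G H|%:R <= 3 * n ^+ 2 / (16 * m).
    apply: (@le_trans _ _ (n + 2 * (edit_distance G H)%:R)).
      by rewrite /n -natrM -natrD ler_nat card_bad_pairs.
    rewrite ler_pdivlMr; last by lra.
    move: hE; rewrite ler_pdivlMr; last by lra.
    nra.
  (* Here [(21/10)^2 * 3/16 < 7/8]. *)
  have c1 : M%:R ^+ 2 * #|bad_pairs G H|%:R <= 7 / 8 * m * n ^+ 2.
    apply: (@le_trans _ _ ((21 / 10 * m) ^+ 2 * (3 * n ^+ 2 / (16 * m)))).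
      by apply: ler_pM; rewrite ?exprn_ge0 //; apply: lerXn2r; rewrite ?nnegrE //; lra.
    rewrite (_ : _ * _ = (21 / 10) ^+ 2 * (3 / 16) * m * n ^+ 2); last by field; lra.
    apply: ler_wpM2r; first exact: sqr_ge0.
    by apply: ler_wpM2r; lra.
  have N0 : 0 <= n ^+ M by apply: exprn_ge0; lra.
  have c2 : #|~: good|%:R * m * n ^+ 2 <= 7 / 8 * n ^+ M * m * n ^+ 2.
    apply: le_trans (ler_wpM2r (sqr_ge0 n) markov) _.
    apply: (le_trans first_moment); apply: le_trans (ler_wpM2r N0 c1) _.
    by rewrite le_eqVlt; apply/orP; left; apply/eqP; ring.
  move: c2; rewrite ler_pM2r ?exprn_gt0 // ler_pM2r; last by lra.
  by rewrite -tot; lra.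
pose covered (A : {set V}) := [set phi : {ffun 'I_M -> V} | A \subset [set phi j | j : 'I_M]].
have sub : good \subset \bigcup_(A in homogeneous_sets G K) covered A.
  apply/subsetP => phi; rewrite inE => hphi.
  have [||S Sim [hom KS]] := @homogeneous_in_image G H _ phi K%:R FH.
  - by rewrite ler1n.
  - by rewrite -mE card_ord -/(B phi); lra.
  rewrite ler_nat in KS; have [A AS cA] := exists_subset_card KS.
  apply/bigcupP; exists A; last by rewrite inE; apply: subset_trans Sim.
  rewrite inE cA eqxx andbT; case/orP: (homogeneous_independentb hom) => h.
    by rewrite (independentb_sub AS h).
  by rewrite (independentb_sub AS h) orbT.
(* Union bound: every good map covers a homogeneous [K]-set. *)
have hub : #|good|%:R * n ^+ K <= #|homogeneous_sets G K|%:R * M%:R ^+ K * n ^+ M.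
  rewrite /n -!natrX -!natrM ler_nat.
  apply: leq_trans (leq_mul (subset_leq_card sub) (leqnn _)) _.
  apply: (@leq_trans ((\sum_(A in homogeneous_sets G K) #|covered A|) * #|V| ^ K)%N).
    rewrite leq_mul2r; apply/orP; right.
    elim/big_rec2: _ => [|A s U _ IH]; first by rewrite cards0.
    by apply: leq_trans (leq_card_setU _ _) _; rewrite leq_add2l.
  rewrite big_distrl /= -mulnA -sum_nat_const; apply: leq_sum => A.
  rewrite inE => /andP[_ /eqP cA].
  by have := card_cover 'I_M A; rewrite card_ord cA.
have N0 : 0 < n ^+ M by apply: exprn_gt0.
rewrite -(ler_pM2r N0).
apply: (@le_trans _ _ (8 * (#|good|%:R * n ^+ K))).
  by rewrite mulrA mulrC; apply: ler_wpM2r => //; apply: exprn_ge0; lra.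
rewrite -!mulrA; apply: ler_wpM2l; first by lra.
apply: (le_trans hub); rewrite -!mulrA; apply: ler_wpM2l => //.
apply: ler_wpM2r; first exact: ltW.
by apply: lerXn2r; rewrite ?nnegrE //; lra.
Qed.

End HomogeneousSets.

(** * Numerical estimates and the choice of parameters *)

Section Numerics.
Variable R : realType.
Implicit Types x a : R.

(** Powers of [1 + t <= e^t] at [t = 1/20] and [t = -1/50]. *)
Lemma expR1_bounds : 265 / 100 <= expR (1 : R) <= 275 / 100.
Proof.
have e20 : expR (1 : R) = expR (1 / 20 : R) ^+ 20 by rewrite -expRM_natl; congr expR; lra.
have e50 : expR (1 : R) = (expR (- (1 / 50) : R) ^+ 50)^-1.
  by rewrite -expRM_natl -expRN; congr expR; lra.
apply/andP; split.
  rewrite e20; apply: (@le_trans _ _ ((21 / 20) ^+ 20)); first by lra.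
  apply: lerXn2r; rewrite ?nnegrE ?expR_ge0 //; first lra.
  by have := expR_ge1Dx (1 / 20 : R); lra.
rewrite e50 -[leRHS]invrK lef_pV2 ?posrE ?exprn_gt0 ?expR_gt0 ?invr_gt0 //; last lra.
apply: (@le_trans _ _ ((49 / 50) ^+ 50)); first by lra.
apply: lerXn2r; rewrite ?nnegrE ?expR_ge0 //; first lra.
by have := expR_ge1Dx (- (1 / 50) : R); lra.
Qed.

Lemma expRn_bounds (n : nat) :
  (265 / 100) ^+ n <= expR (n%:R : R) <= (275 / 100) ^+ n.
Proof.
have /andP[l u] := expR1_bounds.
rewrite -[n%:R]mulr1 expRM_natl; apply/andP; split;
  apply: lerXn2r; rewrite ?nnegrE ?expR_ge0 //; lra.
Qed.

(** Compare fourth roots: [201 < (38/10)^4], and the exponential lies above its tangent at [3],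
    where [e^3 >= 18]. This yields [ln k <= 3.7 * ln (1 / eps)]. *)
Lemma pow4_le_exp a : 9 / 2 <= a -> 201 * a ^+ 4 <= expR (27 / 10 * a).
Proof.
move=> ha; rewrite (_ : 27 / 10 * a = 4%:R * (3 + (27 / 40 * a - 3)));
  last by lra.
rewrite expRM_natl.
apply: (@le_trans _ _ ((38 / 10 * a) ^+ 4)).
  rewrite exprMn; apply: ler_wpM2r; first by apply: exprn_ge0; lra.
  by lra.
apply: lerXn2r; rewrite ?nnegrE ?expR_ge0 //; first lra.
rewrite expRD; have /andP[h _] := expRn_bounds 3.
have := expR_ge1Dx (27 / 40 * a - 3); set t := expR (_ - _) => ht.
have : 18 * t <= expR 3%:R * t by apply: ler_wpM2r; [exact: expR_ge0 | lra].
lra.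
Qed.

(** Because [e^9 < 100^2]. *)
Lemma ln_inv_ge (eps : R) : 0 < eps -> eps < 1 / 100 -> 9 / 2 <= ln (1 / eps).
Proof.
move=> e0 e1.
have h : expR (9 / 2) <= 1 / eps.
  apply: (@le_trans _ _ 100); last first.
    by rewrite ler_pdivlMr //; lra.
  have /andP[_ u] := expRn_bounds 9.
  have e9 : expR 9%:R = expR (9 / 2 : R) ^+ 2 by rewrite -expRM_natl; congr expR; lra.
  have p := expR_gt0 (9 / 2 : R).
  rewrite e9 in u; rewrite leNgt; apply/negP => c; nra.
by rewrite -(expRK (9 / 2)) ler_ln // posrE ?expR_gt0 // divr_gt0.
Qed.

(* The number [L] of choices satisfies
   [L * ln (1 + 16 * k^F) <= ln^4 k / eps + lower order terms],
   and [ln k <= 3.7 * ln (1 / eps)] with [3.7^4 < 200]. *)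
Lemma parameter_choice (eps k delta F : R) :
  0 < eps -> eps < 1 / 100 ->
  k = 200 * (Num.ceil (1 / eps * ln (1 / eps) ^+ 4))%:~R ->
  1 / delta = 16 * k `^ (F - 1) -> 2 <= F -> F <= ln k ->
  exists L : nat, (1 - eps) ^+ L <= delta /\ 16 * (1 + 16 * k `^ F) ^+ L < expR k.
Proof.
move=> e0 e1 kE dE F2 Fk.
have a45 := ln_inv_ge e0 e1; set a := ln (1 / eps) in kE a45.
pose Y := 1 / eps * a ^+ 4.
have ie : 100 <= 1 / eps by rewrite ler_pdivlMr //; lra.
have Y1 : 200 <= Y.
  rewrite /Y; have : 1 <= a ^+ 4 by apply: exprn_ege1; lra.
  have : (9/2) ^+ 4 <= a ^+ 4 by apply: lerXn2r; rewrite ?nnegrE; lra.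
  nra.
have kY : 200 * Y <= k by rewrite kE; have := ceil_ge Y; rewrite -/Y; lra.
(* Rounding up adds at most [200], hence at most [Y]. *)
have kY2 : k <= 201 * Y.
  rewrite kE -/Y; have /andP[+ _] := ceil_itv Y; rewrite intrB; lra.
have k0 : 0 < k by lra.
have l_le : ln k <= 37 / 10 * a.
  rewrite -(expRK (37 / 10 * a)) ler_ln ?posrE ?expR_gt0 //.
  apply: (le_trans kY2); rewrite /Y -{1}(lnK (_ : 1 / eps \is Num.pos)); last first.
    by rewrite posrE divr_gt0.
  rewrite -/a (_ : 37 / 10 * a = a + 27 / 10 * a); last by lra.
  rewrite expRD; have := pow4_le_exp a45; have := expR_gt0 a.
  by move=> h1 h2; rewrite mulrCA; apply: ler_wpM2l => //; apply: ltW.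
have l7 : 7 <= ln k.
  rewrite -(expRK 7) ler_ln ?posrE ?expR_gt0 //.
  have /andP[_ u] := expRn_bounds 7; lra.
set l := ln k in l_le l7 Fk.
have exp3 : 17 <= expR (3 : R) by have /andP[u _] := expRn_bounds 3; lra.
have m1 : 1 <= k `^ F.
  by rewrite -(powRr0 k); apply: ler_powR; lra.
have lnm : ln (1 + 16 * k `^ F) <= 3 + l ^+ 2.
  apply: (@le_trans _ _ (ln (expR 3 * k `^ F))).
    rewrite ler_ln ?posrE ?mulr_gt0 ?expR_gt0 ?powR_gt0 //; last by lra.
    nra.
  rewrite lnM ?posrE ?expR_gt0 ?powR_gt0 // expRK ln_powR -/l; nra.
have d0 : 0 < delta.
  have : 0 < 1 / delta by rewrite dE mulr_gt0 ?powR_gt0.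
  by rewrite div1r invr_gt0.
(* Bounds [ln (1 / delta) = ln 16 + (F - 1) * l], using [F <= l] and [ln 16 <= 3]. *)
pose D := l ^+ 2 - l + 3.
have lnd : - ln delta <= D.
  rewrite -lnV ?posrE // -div1r dE lnM ?posrE ?powR_gt0 // ln_powR -/l.
  have : ln (16 : R) <= 3.
    by rewrite -(expRK 3) ler_ln ?posrE ?expR_gt0 //; lra.
  by rewrite /D; nra.
have D0 : 0 <= D / eps by rewrite divr_ge0 ?(ltW e0) //; rewrite /D; nra.
(* Then [(1 - eps)^L <= exp (- eps * L) <= delta]. *)
pose L := (Num.truncn (D / eps)).+1.
have L1 : D / eps < L%:R by exact: truncnS_gt.
have L2 : L%:R <= D / eps + 1 by rewrite /L -natr1 lerD2r truncn_le.
exists L; split.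
  apply: (@le_trans _ _ (expR (- eps * L%:R))).
    rewrite expRM_natr; apply: lerXn2r; rewrite ?nnegrE ?expR_ge0 ?expR_ge1Dx //; lra.
  rewrite -(lnK (_ : delta \is Num.pos)) ?posrE // ler_expR.
  by move: L1; rewrite ltr_pdivrMr // => L1; lra.
have M0 : 0 < 1 + 16 * k `^ F by lra.
rewrite -(lnK (_ : 1 + 16 * k `^ F \is Num.pos)) ?posrE // -expRM_natl.
apply: (@le_lt_trans _ _ (expR 3 * expR (L%:R * ln (1 + 16 * k `^ F)))).
  by apply: ler_wpM2r; rewrite ?expR_ge0 //; lra.
rewrite -expRD ltr_expR; apply: (lt_le_trans _ kY).
have lnm0 : 0 <= ln (1 + 16 * k `^ F) by apply: ln_ge0; lra.
have l4 : l ^+ 4 <= (37 / 10) ^+ 4 * a ^+ 4.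
  by rewrite -exprMn; apply: lerXn2r; rewrite ?nnegrE; lra.
have h1 : L%:R * ln (1 + 16 * k `^ F) <= (D / eps + 1) * (3 + l ^+ 2).
  by apply: ler_pM => //; lra.
(* The term [- l] of [D], due to the exponent [F - 1], outweighs the constants once [7 <= l]. *)
have h2 : D * (3 + l ^+ 2) <= l ^+ 4.
  rewrite -subr_ge0 /D.
  rewrite (_ : _ - _ = l ^+ 2 * (l - 7) + l * (l - 7) + 10 * l - 9 ); last by ring.
  have : 0 <= l ^+ 2 * (l - 7) by rewrite mulr_ge0 ?sqr_ge0 //; lra.
  have : 0 <= l * (l - 7) by apply: mulr_ge0; lra.
  lra.
have l2 : 49 <= l ^+ 2 by nra.
have h3 : 6 + l ^+ 2 < l ^+ 4 by rewrite (_ : l ^+ 4 = l ^+ 2 * l ^+ 2); [nra | ring].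
have h4 : (D / eps + 1) * (3 + l ^+ 2) + 3 <= l ^+ 4 * (1 / eps) + l ^+ 4.
  rewrite mulrDl (_ : D / eps * _ = D * (3 + l ^+ 2) * (1 / eps)); last by ring.
  have : D * (3 + l ^+ 2) * (1 / eps) <= l ^+ 4 * (1 / eps) by apply: ler_wpM2r => //; lra.
  lra.
(* As [eps < 1/100], the stray [l^4] costs a factor [101/100], and [(37/10)^4 * 101/100 < 200]. *)
have h5 : l ^+ 4 * (1 / eps) + l ^+ 4 <= l ^+ 4 * (1 / eps) * (101 / 100).
  have : 0 <= l ^+ 4 by apply: exprn_ge0; lra.
  nra.
have h6 : l ^+ 4 * (1 / eps) <= (37 / 10) ^+ 4 * Y.
  have -> : (37 / 10) ^+ 4 * Y = (37 / 10) ^+ 4 * a ^+ 4 * (1 / eps).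
    by rewrite /Y; ring.
  by apply: ler_wpM2r => //; lra.
lra.
Qed.

End Numerics.

(** * Comparison of the two counts *)

Theorem theorem2p6 (R : realType) (f : R -> R)
  (f_mono : forall x y : R, 0 < x -> x <= y -> f x <= f y)
  (f_ge2 : forall x : R, 0 < x -> 2 <= f x)
  (f_le_ln : forall x : R, expR 2 <= x -> f x <= ln x)
  (eps : R) (eps_gt0 : 0 < eps) (eps_lt : eps < 1 / 100)
  (k : R) (k_def : k = 200 * (Num.ceil (1 / eps * ln (1 / eps) ^+ 4))%:~R)
  (delta : R) (delta_def : 1 / delta = 16 * k `^ (f k - 1))
  (F : graph_family) (F_her : hereditary F) (F_EH : erdos_hajnal f F)
  (n : nat) (V : finType) (V_n : #|V| = n) (G : sgraph V)
  (G_close : close_to (delta / k) F G) :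
  exists S : {set V},
    delta * n%:R <= #|S|%:R /\
    (max_degree_le (induced G S) (eps * (#|S|%:R - 1)) \/
     max_degree_le (induced (compl G) S) (eps * (#|S|%:R - 1))).
Proof.
case: G_close => H [FH]; rewrite V_n => hE.
have Y1 : 1 <= 1 / eps * ln (1 / eps) ^+ 4.
  have a4 := ln_inv_ge eps_gt0 eps_lt.
  apply: mulr_ege1; first by rewrite ler_pdivlMr //; lra.
  by apply: exprn_ege1; lra.
have k200 : 200 <= k.
  by have := ceil_ge (1 / eps * ln (1 / eps) ^+ 4); rewrite k_def; lra.
have [K kK] : exists K : nat, k = K%:R.
  have : 0 <= Num.ceil (1 / eps * ln (1 / eps) ^+ 4) by rewrite ceil_ge0; lra.
  move: k_def; case: (Num.ceil _) => // c -> _; exists (200 * c)%N.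
  by rewrite natrM.
have k0 : 0 < k by lra.
have fk2 := f_ge2 k k0.
have fkl : f k <= ln k.
  apply: f_le_ln; have /andP[_ u] := expRn_bounds R 2; lra.
have [L [hL1 hL2]] := parameter_choice eps_gt0 eps_lt k_def delta_def fk2 fkl.
set m := k `^ f k in hL2.
have mk : k * k `^ (f k - 1) = m by apply: mulr_powRB1; lra.
have km : k <= m by apply: le1r_powR; lra.
have dE : delta = k / (16 * m).
  rewrite -[delta]invrK -[delta^-1]div1r delta_def -mk; field.
  by rewrite !gt_eqF ?powR_gt0.
have d0 : 0 < delta by rewrite dE divr_gt0 //; lra.
have hE' : (edit_distance G H)%:R <= n%:R ^+ 2 / (32 * m).
  by apply: (le_trans hE); rewrite dE le_eqVlt; apply/orP; left; apply/eqP; field; rewrite !gt_eqF //; lra.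
have [n0|n0] := posnP n.
  by exists set0; rewrite n0 mulr0 cards0; split=> //; left => -[v v0]; exfalso; move: v0; rewrite inE.
have n0R : 0 < n%:R :> R by rewrite ltr0n.
have [nm|nm] := leP n%:R (8 * m).
  (* The maximum with [1] makes the Erdős-Hajnal property applicable and [S] nonempty. *)
  suff [S [hom cS]] : exists S : {set V}, homogeneous G S /\ Num.max 1 (delta * n%:R) <= #|S|%:R.
    exists S; move: cS; rewrite ge_max => /andP[S1 dS]; split=> //.
    by apply: homogeneous_max_degree => //; [exact: ltW | rewrite ler1n in S1].
  set c := Num.max _ _.
  have c1 : 1 <= c by rewrite le_max lexx.
  have [cl|cd] := leP (delta * n%:R) 1.
    have /card_gt0P[v _] : (0 < #|V|)%N by rewrite V_n.
    exists [set v]; split; last by rewrite cards1 /c max_l.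
    by right => x y; rewrite !inE => /eqP-> /eqP->; rewrite adj_irr.
  have cE : c = delta * n%:R by rewrite /c max_r // ltW.
  have [|S _ [hom cS]] := homogeneous_in_image F_her F_EH (G := G) (phi := id) FH c1; last by exists S.
  have ck : c <= k.
    rewrite cE dE mulrAC ler_pdivrMr; last by lra.
    by apply: ler_wpM2l; lra.
  (* Write [c = q * k] with [q = n / (16 m) <= 1]; since [c <= k],
     [c^f(c) <= c^f(k) = q^f(k) * m <= q * m]. *)
  have cpow : c `^ f c <= n%:R / 16.
    apply: (@le_trans _ _ (c `^ f k)).
      by apply: ler_powR => //; apply: f_mono; lra.
    rewrite cE dE (_ : _ * _ = (n%:R / (16 * m)) * k); last by ring.
    have q0 : 0 < n%:R / (16 * m) by rewrite divr_gt0 //; lra.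
    have q1 : n%:R / (16 * m) <= 1 by rewrite ler_pdivrMr; lra.
    rewrite powRM ?(ltW q0) ?(ltW k0) // -/m.
    apply: (@le_trans _ _ (n%:R / (16 * m) * m)).
      by apply: ler_wpM2r; [lra | apply: ge1r_powR; [apply/andP | lra]].
    by rewrite le_eqVlt; apply/orP; left; apply/eqP; field; rewrite gt_eqF //; lra.
  (* Under the identity map only edited pairs are bad, at most [n / 2] of them as [n <= 8 m]. *)
  have cB : (#|[set p : V * V | (p.1 != p.2) && ((p.1, p.2) \in bad_pairs G H)]|
     <= 2 * edit_distance G H)%N.
    apply: leq_trans (card_edited G H); apply/subset_leq_card/subsetP => -[x y].
    by rewrite !inE /=; case: eqP.
  rewrite V_n; move: cB; rewrite -(ler_nat R) natrM => cB.
  have : (edit_distance G H)%:R <= n%:R / 4 :> R.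
    apply: (le_trans hE'); rewrite ler_pdivrMr; last by lra.
    nra.
  lra.
have m10 : 10 <= m by lra.
have K0 : (0 < K)%N by rewrite -(ltr_nat R) -kK.
have mKE : m = K%:R `^ f K%:R by rewrite -kK.
have := many_homogeneous_sets F_her F_EH FH K0 mKE m10.
rewrite V_n => /(_ G nm hE') lower.
apply: contrapT => nS.
(* This weight makes [x * delta * n = k], so that confinement to [delta * n] vertices costs
   [e^k]. *)
pose x : R := 16 * m / n%:R.
have x0 : 0 < x by rewrite divr_gt0 //; lra.
have xn : x * n%:R = 16 * m by rewrite /x divfK // gt_eqF.
have xd : x * (delta * n%:R) = k.
  by rewrite mulrCA xn dE divfK // gt_eqF //; lra.
have upper (G' : sgraph V) :
    (forall U : {set V}, delta * n%:R <= #|U|%:R ->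
       ~ max_degree_le (induced G' U) (eps * (#|U|%:R - 1))) ->
    #|[set A : {set V} | independentb G' A & #|A| == K]|%:R * x ^+ K
      <= expR k * (1 + 16 * m) ^+ L.
  move=> hG'; apply: le_trans (card_indep_le _ _ (ltW x0)) _.
  rewrite -xn -xd -V_n; apply: (@indep_poly_le _ _ _ eps).
  - by rewrite eps_gt0 /=; lra.
  - by rewrite mulr_ge0 // ltW.
  - exact: ltW.
  - by rewrite V_n.
  - by apply: ler_wpM2r => //.
have u1 : #|homogeneous_sets G K|%:R * x ^+ K <= 2 * (expR k * (1 + 16 * m) ^+ L).
  have hG := upper G (fun U dU h => nS (ex_intro _ U (conj dU (or_introl h)))).
  have hcG := upper (compl G) (fun U dU h => nS (ex_intro _ U (conj dU (or_intror h)))).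
  rewrite mulr2n mulrDl mul1r; apply: le_trans (lerD hG hcG).
  rewrite -mulrDl; apply: ler_wpM2r; first by rewrite exprn_ge0 // ltW.
  rewrite -natrD ler_nat; apply: leq_trans (leq_card_setU _ _).
  apply/subset_leq_card/subsetP => A; rewrite !inE.
  by case: eqP; rewrite ?andbT ?andbF.
(* Multiplying the two bounds gives [16 = 8 * 2], the [8] from sampling and the [2] from [G] and its
   complement; the choice of [L] turns [16 * (1 + 16 m)^L] into a second [e^k], and
   [21/10 * e^2 < 16]. *)
have : (16 * m) ^+ K < (16 * m) ^+ K.
  have w0 : 0 < (21 / 10 * m) ^+ K by apply: exprn_gt0; lra.
  apply: (@le_lt_trans _ _ ((21 / 10 * m) ^+ K * (expR k * (16 * (1 + 16 * m) ^+ L)))).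
    rewrite -{1}xn exprMn.
    apply: le_trans (ler_wpM2l _ lower) _; first by rewrite exprn_ge0 // ltW.
    have := ler_wpM2l (ltW w0) u1.
    move: (#|_|%:R) ((21 / 10 * m) ^+ K) (x ^+ K) ((1 + 16 * m) ^+ L) (expR k).
    by move=> h w y P E; lra.
  apply: (@lt_le_trans _ _ ((21 / 10 * m) ^+ K * (expR k * expR k))).
    by rewrite ltr_pM2l // ltr_pM2l // expR_gt0.
  rewrite kK -[K%:R]mulr1 expRM_natl -exprMn -exprMn.
  apply: lerXn2r; rewrite ?nnegrE; [| lra |].
    by rewrite !mulr_ge0 ?expR_ge0 //; lra.
  have /andP[e1 e2] := expR1_bounds R.
  have : expR 1 * expR 1 <= 76 / 10 :> R by nra.
  by nra.
by rewrite ltxx.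
Qed.
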